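(* Let $N$ be a finite set of items with sizes $s(i)>0$, and let $f:2^N\to\mathbb{R}_{\ge 0}$ be normalized, monotone and submodular with $f(\{j\})>0$ for all $j\in N$ and curvature $c\in(0,1]$. Assume no ties occur in any comparison of values, marginal values or densities. Let $\Pi$ be the robust packing policy described in the context. Then $\Pi$ has robustness factor (at least) $$\alpha=\frac{1-x}{2-(2-c)x},$$ where $x$ is the unique root in $[0,1]$ of $\frac{1}{c}\bigl(1-e^{-cz}\bigr)=\frac{1-z}{2-(2-c)z}$; that is, $f(\Pi(\gamma))\ge \alpha\, f(\mathrm{Opt}(\gamma))$ for every capacity $\gamma>0$.
   Context: For $A\subseteq N$ write $s(A)=\sum_{i\in A}s(i)$. $f$ is normalized if $f(\emptyset)=0$, monotone if $f(A)\le f(B)$ for $A\subseteq B$, submodular if $f(A)+f(B)\ge f(A\cup B)+f(A\cap B)$. The curvature is $c=1-\min_{j\in N}\frac{f(N)-f(N\setminus\{j\})}{f(\{j\})}$. For a capacity $\gamma>0$, $\mathrm{Opt}(\gamma)$ is a set $S\subseteq N$ with $s(S)\le\gamma$ maximizing $f(S)$. A policy is a procedure (binary decision tree) that, without knowing $\gamma$, repeatedly chooses an item to attempt; if the item fits (total size of packed items plus it is $\le\gamma$) it is irrevocably packed, otherwise discarded, and the next choice may depend on this history. $\Pi(\gamma)$ is the set packed when the capacity is $\gamma$. The robustness factor of $\Pi$ is $\inf_\gamma f(\Pi(\gamma))/f(\mathrm{Opt}(\gamma))$. Greedy order for capacity $\gamma$: let $N_\gamma=\{i\in N: s(i)\le\gamma\}$,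 $n_\gamma=|N_\gamma|$; set $G_0=\emptyset$ and for $j=1,\dots,n_\gamma$ let $i_j$ maximize $\frac{f(G_{j-1}\cup\{i\})-f(G_{j-1})}{s(i)}$ over $i\in N_\gamma\setminus G_{j-1}$, and $G_j=G_{j-1}\cup\{i_j\}$. Let $k$ be the largest index with $s(G_k)\le\gamma$. Algorithm AGreedy with capacity $\gamma$ returns $G_k$ if $k=n_\gamma$; otherwise it returns $G_k$ if $f(G_k)\ge f(G_k\cup\{i_{k+1}\})-f(G_k)$ and returns $\{i_{k+1}\}$ otherwise. An item $i$ is indispensable if for some capacity $\gamma$ AGreedy returns $\{i\}=\{i_{k+1}\}$ (instead of $G_k$). The policy $\Pi$: First build a list $F$: go through the items in order of non-decreasing size; an item $i$ is put at the front of $F$ if it is indispensable, or if it is the first item of the greedy order for capacity $s(i)$ and $F$ is already nonempty. (So $F$ lists items in strictly decreasing size.) Execution: Let $N'$ be the current candidate set, initially $N$. Step 1: go through $F$ in order; for the current item $i$ attempt to pack it; if it does not fit, set $N'\leftarrow\{i'\in N': s(i')<s(i)\}$ and continue; the first item $i$ of $F$ that fits is packed ($S=\{i\}$, removed from $N'$) and Step 1 ends; if it is indispensable, let $G$ be the set of items preceding $i$ in the greedy order for capacity $s(i)$, otherwise $G=\emptyset$ (also $G=\emptyset$ if no item of $F$ fits). Step 2: for each $i\in G$ in greedy order, attempt to pack it (add to $S$ if it fits) and remove it from $N'$. Step 3: while $N'\ne\emptyset$, let $i_{\max}$ maximize $\frac{f(S\cup\{i\})-f(S)}{s(i)}$ over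 $N'$; if it fits, add it to $S$ and remove it from $N'$; otherwise set $N'\leftarrow\{i\in N': s(i)<s(i_{\max})\}$. Output $S$. *)

(* Defs.v *)
From HB Require Import structures.
From mathcomp Require Export all_boot all_order all_algebra.
From mathcomp Require Export boolp reals sequences exp.

Set Implicit Arguments.
Unset Strict Implicit.
Unset Printing Implicit Defensive.

Import Order.TTheory GRing.Theory Num.Theory.

Local Open Scope ring_scope.

Section SetFunctions.
Variables (R : realType) (N : finType).
Implicit Types f : {set N} -> R.

Definition normalized f := f set0 = 0.

Definition monotone f := forall A B : {set N}, A \subset B -> f A <= f B.

Definition submodular f :=
  forall A B : {set N}, f (A :|: B) + f (A :&: B) <= f A + f B.

(* The default value 1 of the minimum is harmless: for f normalized and
   submodular with f [set j] > 0 all the ratios are at most 1. *)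
Definition curvature f : R :=
  1 - \big[Order.min/1]_(j : N) ((f setT - f (setT :\ j)) / f [set j]).

Definition marginal f (A : {set N}) (i : N) : R := f (i |: A) - f A.

End SetFunctions.

(* Finite binary decision trees: [Attempt C i p q] attempts item i, continuing
   with p if it fits and with q otherwise. The label C is the set of items among
   which i was selected by comparing densities ([set i] when no comparison took
   place); it does not influence the execution and is only read by [tie_free]. *)
Inductive policy (N : finType) : Type :=
| Stop
| Attempt of {set N} & N & policy N & policy N.
Arguments Stop {N}.

Section Packing.
Variables (R : realType) (N : finType) (s : N -> R) (f : {set N} -> R).

Definition set_size (A : {set N}) : R := \sum_(i in A) s i.

Definition fits (g : R) (A : {set N}) (i : N) : bool := set_size A + s i <= g.

Fixpoint pack (g : R) (A : {set N}) (p : policy N) : {set N} :=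
  match p with
  | Stop => A
  | Attempt _ i p1 p0 =>
      if fits g A i then pack g (i |: A) p1 else pack g A p0
  end.

Definition outcome (p : policy N) (g : R) : {set N} := pack g set0 p.

Definition optimal (g : R) (A : {set N}) : Prop :=
  set_size A <= g /\ forall B : {set N}, set_size B <= g -> f B <= f A.

(* Stated without quotients, since f (Opt g) = 0 when no item fits into g. *)
Definition robustness_at_least (a : R) (p : policy N) : Prop :=
  forall (g : R) (A : {set N}), 0 < g -> optimal g A -> a * f A <= f (outcome p g).

Definition density (A : {set N}) (i : N) : R := marginal f A i / s i.

Definition best (A M : {set N}) : option N :=
  [pick i in M | [forall j in M, density A j <= density A i]].

Definition fitting (g : R) : {set N} := [set i | s i <= g].

Fixpoint greedy_from (n : nat) (A M : {set N}) : seq N :=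
  if n is n'.+1 then
    if best A M is Some i then i :: greedy_from n' (i |: A) (M :\ i) else [::]
  else [::].

Definition greedy_order (g : R) : seq N :=
  greedy_from #|fitting g| set0 (fitting g).

Definition greedy_set (g : R) (j : nat) : {set N} :=
  [set i in take j (greedy_order g)].

Definition greedy_index (g : R) : nat :=
  \max_(j < #|fitting g|.+1 | set_size (greedy_set g j) <= g) j.

(* The item i_{k+1}, which is absent exactly when k = #|fitting g|. *)
Definition next_item (g : R) : option N :=
  onth (greedy_order g) (greedy_index g).

Definition agreedy (g : R) : {set N} :=
  let G := greedy_set g (greedy_index g) in
  if next_item g is Some i then
    if marginal f G i <= f G then G else [set i]
  else G.

(* As i_{k+1} does not belong to G_k, the second conjunct says that AGreedy
   takes the branch that returns the singleton. *)
Definition indispensable (i : N) : Prop :=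
  exists2 g : R, 0 < g & next_item g = Some i /\ agreedy g = [set i].

Definition greedy_first (i : N) : bool := ohead (greedy_order (s i)) == Some i.

(* Items of equal size are processed in an arbitrary order: without ties, at
   most one of them enters the list, so the order does not matter. *)
Definition priority_list : seq N :=
  foldl (fun F i =>
           if `[< indispensable i >] || (greedy_first i && (F != [::]))
           then i :: F else F)
        [::] (sort (fun i j => s i <= s j) (enum N)).

Definition predecessors (i : N) : seq N :=
  let o := greedy_order (s i) in take (index i o) o.

(* In all three steps, A is the set of packed items and M the candidate set. *)

(* Every attempt shrinks M, so that #|M| is enough fuel. *)
Fixpoint step3 (n : nat) (A M : {set N}) : policy N :=
  if n is n'.+1 then
    if best A M is Some i then
      Attempt M i (step3 n' (i |: A) (M :\ i))
                  (step3 n' A [set j in M | s j < s i])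
    else Stop
  else Stop.

Fixpoint step2 (G : seq N) (A M : {set N}) : policy N :=
  if G is i :: G' then
    Attempt [set i] i (step2 G' (i |: A) (M :\ i)) (step2 G' A (M :\ i))
  else step3 #|M| A M.

Fixpoint step1 (F : seq N) (M : {set N}) : policy N :=
  if F is i :: F' then
    Attempt [set i] i
      (step2 (if `[< indispensable i >] then predecessors i else [::])
             [set i] (M :\ i))
      (step1 F' [set j in M | s j < s i])
  else step2 [::] set0 M.

Definition robust_policy : policy N := step1 priority_list setT.

Fixpoint tie_free (g : R) (A : {set N}) (p : policy N) : Prop :=
  match p with
  | Stop => True
  | Attempt C i p1 p0 =>
      {in C &, injective (density A)} /\
      (if fits g A i then tie_free g (i |: A) p1 else tie_free g A p0)
  end.

(* No ties in the comparisons performed, for any capacity, by the greedy order,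
   by AGreedy and by the execution of the robust policy. *)
Definition no_ties : Prop :=
  forall g : R, 0 < g ->
  [/\ forall j : nat,
        {in fitting g :\: greedy_set g j &, injective (density (greedy_set g j))},
      forall i : N, next_item g = Some i ->
        let G := greedy_set g (greedy_index g) in f G <> marginal f G i &
      tie_free g set0 robust_policy].

End Packing.

Definition critical_point (R : realType) (c z : R) : Prop :=
  0 <= z <= 1 /\ c^-1 * (1 - expR (- (c * z))) = (1 - z) / (2 - (2 - c) * z).

(* Main.v *)
(* Write phi z = (1 - e^(-cz))/c, the function [gain] below. With O optimal for
   capacity g, G_n the greedy prefixes, k the last n for which G_n fits, T the size
   of G_k, i the next item and rho its marginal value, the greedy choice and the
   curvature give
     f O <= sum_{j <= n} w_j delta_j + (g - s(O :&: G_n)) d_{n+1}   for n <= k,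
   where delta_j and d_j are the greedy marginals and densities, w_j = 1 on O and
   w_j = c off O. These recursions imply f G_k >= phi(T/g) f O. If T >= xg, this
   is at least phi(x) f O; if T < xg, then s i > g - T > (1-x)g and the inequality
   for n = k alone gives f O <= (2 + cx/(1-x)) max(f G_k, rho). At the critical
   point both bounds are the stated ratio, which AGreedy therefore attains.

   The policy does at least as well as AGreedy. Let i be the first item of the
   list F that fits into g. The items of size in (s i, g] are neither
   indispensable nor first in their own greedy order, which forces the greedy
   order for g to start with the predecessors of i followed by i: a larger item
   among them would itself be indispensable or first. If these items fit
   together, the policy packs all of G_k, and AGreedy does not return an
   indispensable i', since i in G_k and s(G_k) < s(i') <= s(i) are contradictory.
   If they do not fit together, AGreedy returns {i}, which the policy packs.
   If no item of F fits, the policy packs G_k and AGreedy returns G_k. *)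
Require Import Defs.
From mathcomp Require topology normedtype realfun.
From mathcomp Require Import ring lra.
Import Order.TTheory GRing.Theory Num.Theory.
Local Open Scope ring_scope.

Set Implicit Arguments.
Unset Strict Implicit.
Unset Printing Implicit Defensive.

(** * The critical point and the exponential bound *)

Section ExponentialBound.
Variables (R : realType) (c : R).
Hypotheses (c_gt0 : 0 < c) (c_le1 : c <= 1).
Implicit Types x y z t u : R.

(** The share of the optimal value secured by a greedy prefix filling the fraction [z] of the
    capacity. *)
Definition gain z : R := c^-1 * (1 - expR (- (c * z))).

(** The reciprocal of [2 + c z / (1 - z)] for [z < 1]: the guarantee when the prefix fills less than
    the fraction [z]. *)
Definition ratio z : R := (1 - z) / (2 - (2 - c) * z).

Lemma ratio_denominator_gt0 z : z <= 1 -> 0 < 2 - (2 - c) * z.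
Proof.
have := c_gt0; have := c_le1 => c1 c0 z1.
have : 0 <= (2 - c) * (1 - z) by apply: mulr_ge0; lra.
by lra.
Qed.

Lemma gain0 : gain 0 = 0.
Proof. by rewrite /gain mulr0 oppr0 expR0 subrr mulr0. Qed.

Lemma gainE z : c * gain z = 1 - expR (- (c * z)).
Proof. by rewrite /gain mulrA divff ?mul1r ?gt_eqF. Qed.

Lemma gain_lt x y : x < y -> gain x < gain y.
Proof.
move=> xy; rewrite -(ltr_pM2l c_gt0) !gainE ltrD2l ltrN2 ltr_expR ltrN2.
by rewrite ltr_pM2l.
Qed.

Lemma gain_le x y : x <= y -> gain x <= gain y.
Proof. by rewrite le_eqVlt => /predU1P[->//|/gain_lt/ltW]. Qed.

Lemma gain_ge0 x : 0 <= x -> 0 <= gain x.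
Proof. by rewrite -{2}gain0 => /gain_le. Qed.

(* Concavity: the increment is at most that along the tangent at [u]. *)
Lemma gainD_le u t : gain (u + t) <= gain u + t * (1 - c * gain u).
Proof.
rewrite -(ler_pM2l c_gt0) mulrDr !gainE subKr mulrDr opprD expRD.
have := expR_gt0 (- (c * u)); have := expR_ge1Dx (- (c * t)).
by nra.
Qed.

(** Used when an optimal item of relative size [t] is stripped off: [u] is then the filled fraction
    of the remaining capacity, [t + (1 - t) * u] that of the whole. The tangent at [u] reduces the
    claim to one free of [t]. *)
Lemma gain_convexity u t : 0 <= u <= 1 -> 0 <= t ->
  gain (t + (1 - t) * u) <= t + (1 - t) * gain u.
Proof.
case/andP=> u0 u1 t0; have := c_gt0; have := c_le1 => c1 c0.
have -> : t + (1 - t) * u = u + t * (1 - u) by ring.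
apply: (le_trans (gainD_le _ _)).
suff : (1 - u) * (1 - c * gain u) <= 1 - gain u by nra.
rewrite -(ler_pM2l c_gt0) [c * (1 - _)]mulrBr mulr1 gainE.
have := expR_ge1Dx (- (c * u)).
move: (expR _) => E E1.
(* The estimate [E >= 1 - c * u] suffices, since [(1 - c + c * u) * (1 - c * u)] exceeds [1 - c] by
   exactly this product. *)
have : 0 <= c * u * (c * (1 - u)) by rewrite !mulr_ge0 ?subr_ge0 // ltW.
suff : (1 - c + c * u) * (1 - c * u) <= (1 - c + c * u) * E by lra.
have : 0 <= c * u by rewrite mulr_ge0 // ltW.
by move=> cu; apply: ler_wpM2l; lra.
Qed.

(** After cross-multiplication the two sides differ by [c * (y - x)]. *)
Lemma ratio_lt x y : x < y -> y <= 1 -> ratio y < ratio x.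
Proof.
have := c_gt0 => c0 xy y1; have x1 : x <= 1 by lra.
rewrite /ratio ltr_pdivrMr ?ratio_denominator_gt0 // mulrAC.
rewrite ltr_pdivlMr ?ratio_denominator_gt0 //.
by nra.
Qed.

Lemma ratio_le1 x : 0 <= x <= 1 -> ratio x <= 1.
Proof.
have := c_gt0 => c0 /andP[x0 x1].
rewrite /ratio ler_pdivrMr ?ratio_denominator_gt0 //.
by nra.
Qed.

Section Existence.
Import topology normedtype realfun numFieldNormedType.Exports.

Lemma critical_point_exists : exists x, critical_point c x.
Proof.
(* The denominator is positive on the interval, so zeros of [h] there are critical points; [h] runs
   from [-1] to [c * gain 1]. *)
pose h z : R := gain z * (2 - (2 - c) * z) - (1 - z).
have hcont : continuous h.
  move=> z; apply: cvgB; last first.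
    by apply: cvgB; [exact: cvg_cst | exact: cvg_id].
  apply: cvgM; last first.
    apply: cvgB; first exact: cvg_cst.
    by apply: cvgM; [exact: cvg_cst | exact: cvg_id].
  apply: cvgM; first exact: cvg_cst.
  apply: cvgB; first exact: cvg_cst.
  apply: continuous_comp; last exact: continuous_expR.
  by apply: cvgN; apply: cvgM; [exact: cvg_cst | exact: cvg_id].
have h0 : h 0 = -1 by rewrite /h gain0; ring.
have h1 : 0 <= h 1.
  have := c_gt0; have := gain_ge0 ler01; rewrite /h => g1 c0.
  by rewrite subrr subr0; apply: mulr_ge0 => //; lra.
have [||x] := @IVT R h 0 1 0 ler01.
- exact: continuous_subspaceT.
- by rewrite h0 ge_min le_max h1 orbT lerN10.
rewrite in_itv /= => /andP[x0 x1] hx; exists x; split; first by rewrite x0.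
apply: (canRL (mulfK _)); first by rewrite gt_eqF ?ratio_denominator_gt0.
by apply/eqP; rewrite -subr_eq0; apply/eqP.
Qed.

End Existence.

(** [gain] is strictly increasing and [ratio] strictly decreasing. *)
Lemma critical_point_unique x y :
  critical_point c x -> critical_point c y -> x = y.
Proof.
wlog xy : x y / x < y.
  move=> xyP x_crit y_crit; have [xy|yx|//] := ltgtP x y; first exact: xyP.
  by symmetry; apply: xyP.
case=> _ xE [/andP[_ y1] yE].
have := ratio_lt xy y1; rewrite /ratio -xE -yE ltNge => /negP[].
exact/ltW/gain_lt.
Qed.

Lemma critical_point_lt1 x : critical_point c x -> 0 <= x < 1.
Proof.
case=> /andP[x0 x1] xE; rewrite x0 lt_neqAle x1 andbT; apply/eqP => x_eq1.
have := gain_lt ltr01.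
by move: xE; rewrite x_eq1 gain0 /gain => ->; rewrite subrr mul0r ltxx.
Qed.

Lemma gain_le_id t : gain t <= t.
Proof.
have := gainD_le 0 t.
by rewrite add0r gain0 mulr0 subr0 mulr1 add0r.
Qed.

(* The first item is stripped off: if it lies in O, both V and the capacity
   decrease, otherwise V decreases by c times its value. *)
Lemma weighted_gain (m : nat) (V g : R) (a : nat -> bool) (w d : nat -> R) :
  (forall j, (j < m)%N -> 0 < w j) -> (forall j, (j < m)%N -> 0 <= d j) ->
  \sum_(j < m) w j <= g ->
  (forall n, (n < m)%N ->
     V <= \sum_(j < n) (if a j then 1 else c) * (w j * d j)
          + (g - \sum_(j < n) (if a j then w j else 0)) * d n) ->
  V * gain ((\sum_(j < m) w j) / g) <= \sum_(j < m) w j * d j.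
Proof.
have sumS n (F : nat -> R) : \sum_(j < n.+1) F j = F 0%N + \sum_(j < n) F j.+1.
  by rewrite big_ord_recl.
elim: m V g a w d => [|m IH] V g a w d w_gt0 d_ge0; rewrite ?big_ord0.
  by rewrite mul0r gain0 mulr0.
rewrite (sumS m w) (sumS m (fun j => w j * d j)).
have w0 : 0 < w 0%N by exact: w_gt0.
have T_ge0 : 0 <= \sum_(j < m) w j.+1.
  by apply: sumr_ge0 => j _; apply/ltW/w_gt0; rewrite ltnS.
have {}IH V' g' := IH V' g' (a \o S) (w \o S) (d \o S); rewrite /= in IH.
set T := \sum_(j < m) w j.+1 in T_ge0 IH *.
set D := \sum_(j < m) w j.+1 * d j.+1 in IH *.
move=> T_le bound; have g_gt0 : 0 < g by lra.
have D_ge0 : 0 <= D.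
  apply: sumr_ge0 => j _; apply: mulr_ge0; last by apply: d_ge0; rewrite ltnS.
  by apply/ltW/w_gt0; rewrite ltnS.
have wd0 : 0 <= w 0%N * d 0%N by apply: mulr_ge0; [exact: ltW|exact: d_ge0].
(* Stripping items can make [V] negative; the left side is then at most 0. *)
have [V_lt0|V_ge0] := ltP V 0.
  apply: le_trans (addr_ge0 wd0 D_ge0); apply: mulr_le0_ge0; first exact: ltW.
  by apply: gain_ge0 => //; rewrite divr_ge0 ?(ltW g_gt0) // addr_ge0 // ltW.
have := bound 0%N isT; rewrite !big_ord0 add0r subr0 => V_le.
(* The bound for [n = 0] reads [V <= g * d 0]: the first item has at least its proportional share of
   [V]. *)
have first_ge : V * (w 0%N / g) <= w 0%N * d 0%N.
  rewrite mulrCA mulrC [leRHS]mulrC ler_pM2r // ler_pdivrMr //.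
  by rewrite [leRHS]mulrC.
case a0: (a 0%N).
- have {}IH : (V - w 0%N * d 0%N) * gain (T / (g - w 0%N)) <= D.
    apply: IH => [j jm|j jm|| n nm]; [exact: w_gt0|exact: d_ge0|lra|].
    have := bound n.+1 nm.
    rewrite (sumS n (fun j => (if a j then 1 else c) * (w j * d j))) a0.
    rewrite (sumS n (fun j => if a j then w j else 0)) a0.
    by lra.
  (* If the first item exhausts the capacity, then [T = 0] and division by 0 yields 0, so the
     formulas below stay valid. *)
  have u_range : 0 <= T / (g - w 0%N) <= 1.
    have [g_w|g_w] := eqVneq (g - w 0%N) 0.
      by rewrite g_w invr0 mulr0 lexx ler01.
    have g_w_gt0 : 0 < g - w 0%N by rewrite lt_neqAle eq_sym g_w /=; lra.
    by rewrite divr_ge0 // ?(ltW g_w_gt0) //= ler_pdivrMr // mul1r; lra.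
  have TE : (w 0%N + T) / g = w 0%N / g + (1 - w 0%N / g) * (T / (g - w 0%N)).
    have [g_w|g_w] := eqVneq (g - w 0%N) 0.
      have -> : T = 0 by lra.
      by rewrite mul0r mulr0 !addr0.
    by field; rewrite g_w gt_eqF.
  rewrite TE; set u := T / (g - w 0%N) in IH u_range *.
  set t := w 0%N / g in first_ge *.
  have t_ge0 : 0 <= t by rewrite divr_ge0 // ltW.
  have gain_le_cvx := gain_convexity u_range t_ge0.
  apply: (le_trans (ler_wpM2l V_ge0 gain_le_cvx)).
  have G_le1 : gain u <= 1.
    by case/andP: u_range => _; apply: le_trans (gain_le_id u).
  rewrite -subr_ge0 in G_le1.
  (* With [G = gain u], [V (t + (1 - t) G) = V t (1 - G) + V G]; the first summand is bounded by
     [first_ge], and [IH] absorbs the rest. *)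
  by have := ler_wpM2r G_le1 first_ge; lra.
- have {}IH : (V - c * (w 0%N * d 0%N)) * gain (T / g) <= D.
    apply: IH => [j jm|j jm|| n nm]; [exact: w_gt0|exact: d_ge0|lra|].
    have := bound n.+1 nm.
    rewrite (sumS n (fun j => (if a j then 1 else c) * (w j * d j))) a0.
    rewrite (sumS n (fun j => if a j then w j else 0)) a0.
    by lra.
  rewrite mulrDl [_ / g + _]addrC; set u := T / g in IH *.
  set t := w 0%N / g in first_ge *.
  apply: (le_trans (ler_wpM2l V_ge0 (gainD_le u t))).
  have slope_ge0 : 0 <= 1 - c * gain u by rewrite gainE // subKr expR_ge0.
  by have := ler_wpM2r slope_ge0 first_ge; lra.
Qed.
End ExponentialBound.

(** * Submodular functions and the greedy order *)

Lemma set_nil (T : finType) : [set i in [::]] = set0 :> {set T}.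
Proof. by apply/setP => i; rewrite !inE. Qed.

Section Submodular.
Variables (R : realType) (N : finType) (f : {set N} -> R).
Hypotheses (f_normalized : normalized f) (f_monotone : monotone f).
Hypothesis f_submodular : submodular f.
Implicit Types (A B : {set N}) (i : N).

Lemma marginal_ge0 A i : 0 <= marginal f A i.
Proof. by rewrite subr_ge0; apply/f_monotone/subsetUr. Qed.

Lemma marginal_le A B i : A \subset B -> marginal f B i <= marginal f A i.
Proof.
move=> AB; have := f_submodular (i |: A) B.
rewrite -setUA (setUidPr AB) => fAB.
have : f A <= f ((i |: A) :&: B) by apply: f_monotone; rewrite subsetI subsetUr.
by rewrite /marginal; lra.
Qed.

Lemma marginal_set0 i : marginal f set0 i = f [set i].
Proof. by rewrite /marginal setU0 f_normalized subr0. Qed.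

(** The marginal of [i] is smallest over the largest set [setT :\ i], where the curvature bounds
    it. *)
Lemma marginal_curvature A i : 0 < f [set i] -> i \notin A ->
  (1 - curvature f) * f [set i] <= marginal f A i.
Proof.
move=> fi_gt0 iA; apply: (@le_trans _ _ (marginal f (setT :\ i) i)); last first.
  by apply: marginal_le; rewrite subsetD1 subsetT.
rewrite /marginal setD1K ?inE // -ler_pdivlMr // /curvature subKr.
exact: bigmin_le.
Qed.

(** The elements of [B :\: A] are added one by one, each with a marginal no larger than over [A]. *)
Lemma value_union_le A B :
  f (A :|: B) <= f A + \sum_(i in B :\: A) marginal f A i.
Proof.
have -> : A :|: B = A :|: [set i in enum (B :\: A)].
  by apply/setP => i; rewrite !inE mem_enum !inE; case: (i \in A).
rewrite -big_enum /=; elim: (enum _) => [|i l IH].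
  by rewrite big_nil addr0 set_nil setU0.
rewrite big_cons set_cons setUCA.
have := marginal_le i (subsetUl A [set j in l]).
by move: IH; rewrite /marginal; lra.
Qed.

End Submodular.

Section Greedy.
Variables (R : realType) (N : finType) (s : N -> R) (f : {set N} -> R).
Hypothesis s_gt0 : forall i : N, 0 < s i.
Implicit Types (g : R) (A M : {set N}) (i : N).
Local Notation order := (greedy_order s f).
Local Notation prefix := (greedy_set s f).
Local Notation size_of := (set_size s).

Lemma bestP A M i : best s f A M = Some i ->
  i \in M /\ forall j, j \in M -> density s f A j <= density s f A i.
Proof.
rewrite /best; case: pickP => // i' /andP[iM /forallP i_max] [<-]; split=> //.
by move=> j jM; apply: (implyP (i_max j)).
Qed.

Lemma best_exists A M i : i \in M -> exists j, best s f A M = Some j.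
Proof.
move=> iM; rewrite /best; case: pickP => [j _|no_max]; first by exists j.
case: (Order.TotalTheory.arg_maxP (density s f A) iM) => j jM j_max.
by have := no_max j; rewrite (jM : j \in M) => /forallP[] k; apply/implyP/j_max.
Qed.

Lemma size_greedy_from n A M :
  (n <= #|M|)%N -> size (greedy_from s f n A M) = n.
Proof.
elim: n A M => //= n IH A M nM.
have /card_gt0P[i iM] : (0 < #|M|)%N by apply: leq_trans nM.
have [j jE] := best_exists A iM; rewrite jE /= IH //.
have [jM _] := bestP jE.
by rewrite (cardsD1 j M) jM in nM.
Qed.

Lemma greedy_from_subset n A M i : i \in greedy_from s f n A M -> i \in M.
Proof.
elim: n A M => //= n IH A M; case bE: best => [j|] //.
have [jM _] := bestP bE; rewrite inE => /predU1P[->//|/IH].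
by rewrite inE => /andP[].
Qed.

Lemma uniq_greedy_from n A M : uniq (greedy_from s f n A M).
Proof.
elim: n A M => //= n IH A M; case bE: best => [j|] //=; rewrite IH andbT.
by apply/negP => /greedy_from_subset; rewrite !inE eqxx.
Qed.

Lemma nth_greedy_from n A M m (i0 : N) : (m < size (greedy_from s f n A M))%N ->
  let T := [set i in take m (greedy_from s f n A M)] in
  best s f (T :|: A) (M :\: T) = Some (nth i0 (greedy_from s f n A M) m).
Proof.
elim: n A M m => //= n IH A M m; case bE: best => [j|] //=.
case: m => [|m] lt_m /=.
  by rewrite set_nil set0U setD0.
rewrite -(IH _ _ _ lt_m) set_cons; congr best.
  by rewrite -setUA setUCA.
by rewrite setDDl.
Qed.

Lemma size_order g : size (order g) = #|fitting s g|.
Proof. exact: size_greedy_from. Qed.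

Lemma uniq_order g : uniq (order g).
Proof. exact: uniq_greedy_from. Qed.

(** A duplicate-free list inside [fitting s g] with as many entries as that set exhausts it. *)
Lemma mem_order g i : (i \in order g) = (s i <= g).
Proof.
have <- : (i \in fitting s g) = (s i <= g) by rewrite inE.
have sub : {subset order g <= enum (fitting s g)}.
  by move=> j /greedy_from_subset; rewrite mem_enum.
have [|_ ->] := uniq_min_size (uniq_order g) sub; last by rewrite mem_enum.
by rewrite size_order -cardE.
Qed.

Lemma prefix0 g : prefix g 0 = set0.
Proof. by apply/setP => i; rewrite !inE take0. Qed.

Lemma prefixS g n i0 : (n < size (order g))%N ->
  prefix g n.+1 = nth i0 (order g) n |: prefix g n.
Proof.
move=> n_lt; apply/setP => i.
by rewrite /greedy_set (take_nth i0 n_lt) !inE mem_rcons inE.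
Qed.

Lemma nth_order_notin g n i0 : (n < size (order g))%N ->
  nth i0 (order g) n \notin prefix g n.
Proof.
move=> n_lt; rewrite inE; apply/negP => /(nthP i0)[m].
rewrite size_takel ?(ltnW n_lt) // => m_lt; rewrite nth_take // => /eqP.
rewrite nth_uniq ?uniq_order ?(ltn_trans m_lt) // => /eqP mn.
by rewrite mn ltnn in m_lt.
Qed.

Lemma prefix_size g : prefix g (size (order g)) = fitting s g.
Proof. by apply/setP => i; rewrite !inE take_size mem_order. Qed.

Lemma prefix_subset g m n : (m <= n)%N -> prefix g m \subset prefix g n.
Proof.
move=> mn; apply/subsetP => i; rewrite !inE -(subnKC mn) takeD mem_cat.
by move=> ->.
Qed.

Lemma prefix_fits g n i : i \in prefix g n -> s i <= g.
Proof. by rewrite inE => /mem_take; rewrite mem_order. Qed.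

Lemma nth_order_best g n i0 : (n < size (order g))%N ->
  best s f (prefix g n) (fitting s g :\: prefix g n)
    = Some (nth i0 (order g) n).
Proof.
by move=> n_lt; rewrite -(nth_greedy_from i0 n_lt) setU0.
Qed.

Lemma nth_order_max g n i0 j : (n < size (order g))%N -> s j <= g ->
  j \notin prefix g n ->
  density s f (prefix g n) j <= density s f (prefix g n) (nth i0 (order g) n).
Proof.
move=> n_lt j_fits jP; have [_ ->] // := bestP (nth_order_best i0 n_lt).
by rewrite !inE j_fits andbT; move: jP; rewrite inE.
Qed.

Lemma set_sizeU1 A i : i \notin A -> size_of (i |: A) = s i + size_of A.
Proof. by move=> iA; rewrite /set_size big_setU1. Qed.

Lemma set_size_le A M : A \subset M -> size_of A <= size_of M.
Proof.
move=> AM; rewrite /set_size [leRHS](big_setID A) /= (setIidPr AM).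
by rewrite lerDl; apply: sumr_ge0 => i _; apply/ltW/s_gt0.
Qed.

Lemma set_size0 : size_of set0 = 0.
Proof. by rewrite /set_size big_set0. Qed.

Lemma greedy_index_size g : (greedy_index s f g <= size (order g))%N.
Proof.
by rewrite size_order /greedy_index; apply/bigmax_leqP => j _; rewrite -ltnS.
Qed.

Lemma greedy_index_fits g :
  0 < g -> size_of (prefix g (greedy_index s f g)) <= g.
Proof.
move=> g_gt0; rewrite /greedy_index.
have P0 : size_of (prefix g 0) <= g.
  by rewrite prefix0 set_size0 ltW.
apply: (big_ind (fun n => size_of (prefix g n) <= g)) => //.
by move=> m n mg ng; rewrite /maxn; case: ifP.
Qed.

Lemma greedy_index_max g n : (n <= size (order g))%N ->
  size_of (prefix g n) <= g -> (n <= greedy_index s f g)%N.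
Proof.
rewrite size_order -ltnS => n_lt n_fits.
exact: (@leq_bigmax_cond _ _ (fun j : 'I_(#|fitting s g|.+1) => j : nat)
  (Ordinal n_lt)).
Qed.

Lemma next_item_nth g i i0 : next_item s f g = Some i ->
  (greedy_index s f g < size (order g))%N /\
  nth i0 (order g) (greedy_index s f g) = i.
Proof.
by rewrite /next_item => nextE; rewrite -onthTE nextE (onth_nth i0 _ _ _ nextE).
Qed.

Lemma greedy_first_index i : greedy_first s f i -> index i (order (s i)) = 0%N.
Proof.
by rewrite /greedy_first; case: (order (s i)) => //= j o /eqP[->]; rewrite eqxx.
Qed.

End Greedy.

(** * The approximation ratio of AGreedy *)

Section AGreedy.
Variables (R : realType) (N : finType) (s : N -> R) (f : {set N} -> R) (c : R).
Hypothesis s_gt0 : forall i : N, 0 < s i.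
Hypotheses (f_normalized : normalized f) (f_monotone : monotone f).
Hypotheses (f_submodular : submodular f) (f_gt0 : forall j : N, 0 < f [set j]).
Hypotheses (c_curvature : curvature f = c) (c_gt0 : 0 < c) (c_le1 : c <= 1).
Variables (g : R) (i0 : N).
Local Notation order := (greedy_order s f g).
Local Notation prefix := (greedy_set s f g).
Local Notation size_of := (set_size s).
Local Notation item := (nth i0 order).

Let w j := s (item j).
Let d j := density s f (prefix j) (item j).

Let wd j : w j * d j = marginal f (prefix j) (item j).
Proof. by rewrite mulrC divfK // gt_eqF. Qed.

Let d_ge0 j : 0 <= d j.
Proof. by apply: divr_ge0; [exact: marginal_ge0|exact: ltW]. Qed.

Let item_fits j : (j < size order)%N -> s (item j) <= g.
Proof. by move=> j_lt; rewrite -(mem_order s f) mem_nth. Qed.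

(** The item chosen at step [n] was already available at step [m], with a density no smaller. *)
Lemma density_nonincreasing m n : (m <= n < size order)%N -> d n <= d m.
Proof.
case/andP=> mn n_lt.
apply: (@le_trans _ _ (density s f (prefix m) (item n))).
  rewrite ler_pM2r ?invr_gt0 //; apply: marginal_le => //.
  exact: prefix_subset.
apply: nth_order_max => //; [exact: leq_ltn_trans n_lt|exact: item_fits|].
by apply: contra (nth_order_notin i0 n_lt); apply/subsetP/prefix_subset.
Qed.

Lemma value_prefix n :
  (n <= size order)%N -> f (prefix n) = \sum_(j < n) w j * d j.
Proof.
elim: n => [|n IH] n_le; first by rewrite prefix0 f_normalized big_ord0.
by rewrite big_ord_recr /= -IH ?(ltnW n_le) // wd (prefixS i0) // addrC subrK.
Qed.

Lemma size_inter_prefix (A : {set N}) n : (n <= size order)%N ->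
  size_of (A :&: prefix n) = \sum_(j < n) (if item j \in A then w j else 0).
Proof.
elim: n => [|n IH] n_le; first by rewrite prefix0 setI0 set_size0 big_ord0.
rewrite big_ord_recr /= -IH ?(ltnW n_le) // (prefixS i0) // setIUr.
case: ifP => itemA.
  rewrite (setIidPr _) ?sub1set // set_sizeU1 1?addrC // inE negb_and.
  by rewrite nth_order_notin ?orbT.
rewrite addr0 (_ : A :&: [set item n] = set0) ?set0U //.
by apply/setP=> i; rewrite !inE andbC; case: eqP => // ->; rewrite itemA.
Qed.

Lemma size_prefix n :
  (n <= size order)%N -> size_of (prefix n) = \sum_(j < n) w j.
Proof.
move=> n_le; rewrite -[prefix n]setTI size_inter_prefix //.
by apply: eq_bigr => j _; rewrite inE.
Qed.

(** A prefix item outside [A] adds at least [1 - c] times its singleton value, which dominates its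
    greedy marginal. *)
Lemma value_union_prefix_ge (A : {set N}) n : (n <= size order)%N ->
  f A + \sum_(j < n) (if item j \in A then 0 else (1 - c) * (w j * d j))
    <= f (A :|: prefix n).
Proof.
elim: n => [|n IH] n_le; first by rewrite prefix0 setU0 big_ord0 addr0.
rewrite big_ord_recr /= addrA.
apply: (le_trans (lerD (IH (ltnW n_le)) (lexx _))).
rewrite (prefixS i0) // setUCA; case: ifP => itemA.
  by rewrite addr0; apply: f_monotone; apply: subsetUr.
have item_notin : item n \notin A :|: prefix n.
  by rewrite inE negb_or itemA nth_order_notin.
have := marginal_curvature f_monotone f_submodular (f_gt0 _) item_notin.
have := marginal_le f_monotone f_submodular (item n) (sub0set (prefix n)).
rewrite wd marginal_set0 // c_curvature {2}/marginal => single_ge curv_ge.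
have : (1 - c) * marginal f (prefix n) (item n) <= (1 - c) * f [set item n].
  by apply: ler_wpM2l => //; rewrite subr_ge0.
by lra.
Qed.

Lemma fits_subset (A : {set N}) i : size_of A <= g -> i \in A -> s i <= g.
Proof.
move=> A_fits iA; apply: le_trans A_fits.
have -> : s i = size_of [set i] by rewrite /set_size big_set1.
by apply: set_size_le => //; rewrite sub1set.
Qed.

(** Two estimates of [f (A :|: prefix n)] are combined: from below by curvature, from above by
    submodularity, where the missing items of [A] have density at most [d n]. *)
Lemma value_le_prefix (A : {set N}) n : size_of A <= g -> (n < size order)%N ->
  f A <= \sum_(j < n) (if item j \in A then 1 else c) * (w j * d j)
         + (g - size_of (A :&: prefix n)) * d n.
Proof.
move=> A_fits n_lt; have n_le := ltnW n_lt.
have := value_union_prefix_ge A n_le; rewrite setUC.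
have := value_union_le f_monotone f_submodular (prefix n) A.
have : \sum_(i in A :\: prefix n) marginal f (prefix n) i
    <= (g - size_of (A :&: prefix n)) * d n.
  apply: (@le_trans _ _ (size_of (A :\: prefix n) * d n)).
    rewrite mulr_suml; apply: ler_sum => i; rewrite inE => /andP[iP iA].
    rewrite mulrC -ler_pdivrMr //; apply: nth_order_max => //.
    exact: fits_subset iA.
  apply: ler_wpM2r => //; rewrite lerBrDl; apply: le_trans A_fits.
  by rewrite /set_size [leRHS](big_setID (prefix n)).
rewrite value_prefix // => m_le u_le u_ge.
have -> : \sum_(j < n) (if item j \in A then 1 else c) * (w j * d j)
    = \sum_(j < n) w j * d j
      - \sum_(j < n) (if item j \in A then 0 else (1 - c) * (w j * d j)).
  by rewrite -sumrB; apply: eq_bigr => j _; case: ifP => _; ring.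
by lra.
Qed.

Hypothesis g_gt0 : 0 < g.
Local Notation k := (greedy_index s f g).

Lemma prefix_gain (A : {set N}) n : size_of A <= g -> size_of (prefix n) <= g ->
  (n <= size order)%N ->
  f A * gain c (size_of (prefix n) / g) <= f (prefix n).
Proof.
move=> A_fits P_fits n_le; rewrite value_prefix //.
move: P_fits; rewrite size_prefix // => P_fits.
apply: (weighted_gain c_gt0 c_le1 (a := fun j => item j \in A)) => //.
  by move=> j _; exact: s_gt0.
move=> m mn /=; have m_lt := leq_trans mn n_le.
by rewrite -size_inter_prefix ?(ltnW m_lt) //; apply: value_le_prefix.
Qed.

(** The weights depending on [A] are removed term by term: the slack is [c * (w j * d n)] for an
    item of [A] and [(1 - c) * (w j * d j - w j * d n)] for any other. *)
Lemma value_le_next (A : {set N}) n : size_of A <= g -> (n < size order)%N ->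
  f A <= f (prefix n) + (g - (1 - c) * size_of (prefix n)) * d n.
Proof.
move=> A_fits n_lt; have n_le := ltnW n_lt.
apply: (le_trans (value_le_prefix A_fits n_lt)).
rewrite value_prefix // size_prefix // size_inter_prefix //.
set P := \sum_(j < n) w j; set I := \sum_(j < n) (if _ then w j else 0).
set F := \sum_(j < n) w j * d j; set W := \sum_(j < n) _ * (w j * d j).
suff : W - I * d n <= F - (1 - c) * (P * d n) by lra.
rewrite /P !mulr_suml mulr_sumr -!sumrB; apply: ler_sum => j _.
have w_gt0 : 0 < w j by exact: s_gt0.
have dn_ge0 : 0 <= c * (w j * d n).
  exact: mulr_ge0 (ltW c_gt0) (mulr_ge0 (ltW w_gt0) (d_ge0 n)).
have d_le : 0 <= w j * d j - w j * d n.
  rewrite subr_ge0 ler_pM2l //; apply: density_nonincreasing.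
  by rewrite (ltnW (ltn_ord j)).
have slack_ge0 : 0 <= (1 - c) * (w j * d j - w j * d n).
  by rewrite mulr_ge0 // subr_ge0.
by case: ifP => _; lra.
Qed.

Lemma agreedy_value (A : {set N}) x : critical_point c x -> size_of A <= g ->
  ratio c x * f A <= f (agreedy s f g).
Proof.
move=> x_crit A_fits.
have [x_ge0 x_lt1] := andP (critical_point_lt1 c_gt0 x_crit).
have fA_ge0 : 0 <= f A by rewrite -f_normalized f_monotone // sub0set.
rewrite /agreedy; have k_le : (k <= size order)%N by exact: greedy_index_size.
have P_fits : size_of (prefix k) <= g by exact: greedy_index_fits.
case nextE: (next_item s f g) => [i|]; last first.
  have kE : k = size order.
    by apply/eqP; rewrite eqn_leq k_le -onthNE -/(next_item s f g) nextE.
  rewrite kE prefix_size //; apply: (@le_trans _ _ (f A)).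
    by rewrite ler_piMl // ratio_le1 // x_ge0 ltW.
  apply: f_monotone; apply/subsetP => j jA; rewrite inE.
  exact: fits_subset jA.
have [k_lt /esym iE] := next_item_nth i0 nextE.
(* The returned set has a value [v] above both quantities, because [f [set i]] is at least the
   marginal of [i]. *)
suff bound v : f (prefix k) <= v -> marginal f (prefix k) i <= v ->
    ratio c x * f A <= v.
  case: ifP => [m_le|/negbT]; first exact: bound.
  rewrite -ltNge => /ltW m_ge; rewrite -marginal_set0 //.
  have m_set0 : marginal f (prefix k) i <= marginal f set0 i.
    by apply: marginal_le => //; apply: sub0set.
  by apply: bound => //; apply: le_trans m_set0.
move=> v_ge1 v_ge2.
have [T_ge|T_lt] := leP (x * g) (size_of (prefix k)).
  apply: le_trans v_ge1; apply: le_trans (prefix_gain A_fits P_fits k_le).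
  rewrite mulrC ler_wpM2l //; case: x_crit => _; rewrite /ratio => <-.
  by apply: (gain_le c_gt0); rewrite ler_pdivlMr.
have overflow : g < size_of (prefix k) + w k.
  rewrite addrC -set_sizeU1 ?nth_order_notin // -prefixS // ltNge.
  by apply/negP => /(greedy_index_max _); rewrite k_lt ltnn => /(_ isT).
have := value_le_next A_fits k_lt.
have wdE := wd k; rewrite -iE in wdE.
move: overflow T_lt P_fits v_ge1 v_ge2 (d_ge0 k); rewrite -wdE.
have w_gt0 : 0 < w k by exact: s_gt0.
move: (size_of _) (w k) w_gt0 (d k) => T z z_gt0 e.
move=> overflow T_lt T_le v_ge1 v_ge2 e_ge0 A_le.
have T_lt_g : T < g.
  by apply: (lt_trans T_lt); rewrite -[ltRHS]mul1r ltr_pM2r.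
rewrite /ratio mulrAC ler_pdivrMr ?ratio_denominator_gt0 ?(ltW x_lt1) //.
(* From [(1 - x) T <= x (g - T)] and [g - T < z]: after multiplication by [1 - x], the parts
   [f G_k], [(g - T) e] and [c T e] of the bound are at most [(1 - x) v], [(1 - x) v] and
   [c x v]. *)
have Te_le : (1 - x) * (T * e) <= x * v.
  apply: (@le_trans _ _ (x * ((g - T) * e))).
    by rewrite !mulrA ler_wpM2r //; lra.
  by rewrite ler_wpM2l //; apply: le_trans v_ge2; rewrite ler_wpM2r //; lra.
have gTe_le : (g - T) * e <= v.
  by apply: le_trans v_ge2; rewrite ler_wpM2r //; lra.
have cTe_le := ler_wpM2l (ltW c_gt0) Te_le.
have x_le1 : 0 <= 1 - x by rewrite subr_ge0 ltW.
have := ler_wpM2l x_le1 A_le.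
have := ler_wpM2l x_le1 gTe_le.
have := ler_wpM2l x_le1 v_ge1.
by lra.
Qed.
End AGreedy.

(** * The robust policy *)

Section RobustPolicy.
Variables (R : realType) (N : finType) (s : N -> R) (f : {set N} -> R).
Hypothesis s_gt0 : forall i : N, 0 < s i.
Hypotheses (f_normalized : normalized f) (f_monotone : monotone f).
Hypothesis f_submodular : submodular f.
Local Notation order := (greedy_order s f).
Local Notation prefix := (greedy_set s f).
Local Notation size_of := (set_size s).
Hypothesis densities_distinct : forall (g : R) (j : nat), 0 < g ->
  {in fitting s g :\: prefix g j &, injective (density s f (prefix g j))}.
Implicit Types (g h : R) (A M : {set N}) (i j : N).

(** * Greedy orders for different capacities *)

Lemma order_next g n i0 i : (n < size (order g))%N -> s i <= g ->
  i \notin prefix g n ->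
  (forall j, s j <= g -> j \notin prefix g n ->
     density s f (prefix g n) j <= density s f (prefix g n) i) ->
  nth i0 (order g) n = i.
Proof.
move=> n_lt i_fits iP i_max; have g_gt0 : 0 < g by apply: lt_le_trans i_fits.
have item_fits : s (nth i0 (order g) n) <= g.
  by rewrite -(mem_order s f) mem_nth.
have item_notin := nth_order_notin i0 n_lt.
apply: (densities_distinct (j := n) g_gt0);
  rewrite ?in_setD ?iP ?item_notin ?inE //.
by apply/le_anti; rewrite i_max //= nth_order_max.
Qed.

(** Lowering the capacity discards only items that were not chosen, so each maximizer stays one;
    without ties it is again the choice. *)
Lemma take_order_le g h n : h <= g -> (n <= size (order g))%N ->
  (forall i, i \in prefix g n -> s i <= h) ->
  (n <= size (order h))%N /\ take n (order h) = take n (order g).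
Proof.
move=> hg; elim: n => [|n IH] n_le small; first by rewrite !take0.
case oE : (order g) n_le => [//|i0 o]; rewrite -{o}oE => n_lt.
have [|i /(subsetP (prefix_subset _ _ _ (leqnSn n))) iP|n_le' takeE] := IH.
- exact: ltnW.
- exact: small.
have PE : prefix h n = prefix g n by rewrite /greedy_set takeE.
have b_notin := nth_order_notin i0 n_lt; set b := nth i0 (order g) n in b_notin.
have b_small : s b <= h by apply: small; rewrite (prefixS i0) // setU11.
have n_lt' : (n < size (order h))%N.
  rewrite ltn_neqAle n_le' andbT; apply/eqP => nE; move: b_notin.
  by rewrite -PE {1}nE prefix_size inE b_small.
split=> //; rewrite !(take_nth i0) // takeE; congr rcons.
apply: order_next; rewrite ?PE // => j j_fits jP.
by apply: nth_order_max => //; apply: le_trans hg.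
Qed.

Lemma next_item_value g i : 0 < g -> next_item s f g = Some i ->
  agreedy s f g = [set i] ->
  f (prefix g (greedy_index s f g))
    < marginal f (prefix g (greedy_index s f g)) i.
Proof.
(* In the other branch the prefix would equal [[set i]], but the next item lies outside it. *)
move=> g_gt0 nextE; rewrite /agreedy nextE; case: ifP => [_ PE|/negbT].
  set k := greedy_index s f g in nextE PE *.
  have [k_lt iE] := next_item_nth i nextE.
  by have := nth_order_notin i k_lt; rewrite iE PE inE eqxx.
by rewrite -ltNge.
Qed.

(** The densities before [i] are at least its density [d], so the prefix size times [d] is at most
    the prefix value, which is below [s i * d]. *)
Lemma next_item_size g i : 0 < g -> next_item s f g = Some i ->
  agreedy s f g = [set i] -> size_of (prefix g (greedy_index s f g)) < s i.
Proof.
move=> g_gt0 nextE agreedyE.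
have value_lt := next_item_value g_gt0 nextE agreedyE.
set k := greedy_index s f g in nextE value_lt *.
have [k_lt iE] := next_item_nth i nextE; rewrite -/k in k_lt iE.
have mE : marginal f (prefix g k) i = s i * density s f (prefix g k) i.
  by rewrite mulrC divfK ?gt_eqF.
have P_ge0 : 0 <= f (prefix g k) by rewrite -f_normalized f_monotone // sub0set.
have d_gt0 : 0 < density s f (prefix g k) i.
  by apply: divr_gt0 => //; apply: le_lt_trans value_lt.
rewrite -(ltr_pM2r d_gt0) -mE; apply: le_lt_trans value_lt.
rewrite (size_prefix i (ltnW k_lt)).
rewrite (value_prefix s_gt0 f_normalized i (ltnW k_lt)).
rewrite mulr_suml; apply: ler_sum => j _; rewrite ler_pM2l // -{1}iE.
by apply: density_nonincreasing => //; rewrite (ltnW (ltn_ord j)).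
Qed.

Lemma indispensable_nth g n i0 : (n < size (order g))%N ->
  size_of (prefix g n) <= g < size_of (prefix g n) + s (nth i0 (order g) n) ->
  f (prefix g n) < marginal f (prefix g n) (nth i0 (order g) n) ->
  greedy_index s f g = n /\ indispensable s f (nth i0 (order g) n).
Proof.
move=> n_lt /andP[P_fits overflow] value_lt.
have g_gt0 : 0 < g.
  apply: lt_le_trans (s_gt0 (nth i0 (order g) n)) _.
  by rewrite -(mem_order s f) mem_nth.
have kE : greedy_index s f g = n.
  apply/eqP; rewrite eqn_leq (greedy_index_max (ltnW n_lt)) // andbT leqNgt.
  apply/negP => nk; move: overflow; rewrite ltNge => /negP[].
  rewrite addrC -set_sizeU1 ?nth_order_notin // -prefixS //.
  apply: le_trans (greedy_index_fits _ _ g_gt0).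
  by apply: set_size_le => //; apply: prefix_subset.
split=> //; exists g => //.
have nextE : next_item s f g = Some (nth i0 (order g) n).
  rewrite /next_item kE onthE (nth_map i0) //.
by rewrite /agreedy nextE kE leNgt value_lt.
Qed.

(** The witness capacity can be replaced by [s i]: the prefix is smaller than [i], so its items fit
    into [s i] and the greedy order starts alike. *)
Lemma indispensable_prefix i : indispensable s f i ->
  let P := prefix (s i) (index i (order (s i))) in
  size_of P < s i /\ f P < marginal f P i.
Proof.
case=> g g_gt0 [nextE agreedyE].
have := next_item_size g_gt0 nextE agreedyE.
have := next_item_value g_gt0 nextE agreedyE.
set k := greedy_index s f g in nextE *.
have [k_lt iE] := next_item_nth i nextE; rewrite -/k in k_lt iE.
have i_fits : s i <= g by rewrite -(mem_order s f) -iE mem_nth.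
move=> value_lt size_lt.
have [j|k_lt' takeE] := take_order_le i_fits k_lt.
- rewrite (prefixS i) // iE in_setU1 => /predU1P[->//|jP].
  exact: fits_subset (ltW size_lt) jP.
have takeE' : take k (order (s i)) = take k (order g).
  by rewrite -[LHS](take_takel _ (leqnSn k)) takeE take_takel.
have -> : index i (order (s i)) = k.
  have iE' : nth i (order (s i)) k = i.
    by rewrite -(nth_take i (ltnSn k)) takeE nth_take.
  by rewrite -[X in index X _]iE' index_uniq // uniq_order.
by rewrite /= /greedy_set takeE'.
Qed.

Lemma take_order_ge g i : s i <= g ->
  indispensable s f i \/ greedy_first s f i ->
  (forall b, s i < s b <= g ->
     ~ indispensable s f b /\ ~~ greedy_first s f b) ->
  let n := (index i (order (s i))).+1 in
  (n <= size (order g))%N /\ take n (order g) = take n (order (s i)).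
Proof.
move=> i_fits i_listed none_between; set n := index i (order (s i)).
have n_lt : (n < size (order (s i)))%N by rewrite index_mem mem_order.
have iE : nth i (order (s i)) n = i by rewrite nth_index // mem_order.
suff take_eq m : (m <= n.+1)%N ->
    (m <= size (order g))%N /\ take m (order g) = take m (order (s i)).
  exact: take_eq.
elim: m => [|m IH] mn; first by rewrite !take0.
have [m_le takeE] := IH (ltnW mn).
have PE : prefix g m = prefix (s i) m by rewrite /greedy_set takeE.
have i_notin : i \notin prefix g m.
  rewrite PE; apply: contra (nth_order_notin i n_lt); rewrite iE.
  exact/subsetP/prefix_subset.
have m_lt : (m < size (order g))%N.
  rewrite ltn_neqAle m_le andbT; apply/eqP => mE; move: i_notin.
  by rewrite mE prefix_size inE i_fits.
split=> //; set b := nth i (order g) m.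
have b_fits : s b <= g by rewrite -(mem_order s f) mem_nth.
have prefix_small j : j \in prefix g m -> s j <= s i.
  by rewrite PE => /prefix_fits.
have [b_le|b_gt] := leP (s b) (s i).
  have [j|_ ->//] := take_order_le i_fits m_lt.
  by rewrite (prefixS i) // in_setU1 => /predU1P[->//|/prefix_small].
(* A larger next item [b] is excluded: it also has position [m] in its own greedy order, so it is
   first there if [m = 0] and shown indispensable otherwise. *)
have [b_disp b_first] := none_between b (introT andP (conj b_gt b_fits)).
have [j|m_lt' takeE'] := take_order_le b_fits m_lt.
  rewrite (prefixS i) // in_setU1 => /predU1P[->//|/prefix_small j_le].
  exact: le_trans (ltW b_gt).
have bE : nth i (order (s b)) m = b.
  by rewrite -(nth_take i (ltnSn m)) takeE' nth_take.
have PE' : prefix (s b) m = prefix g m.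
  rewrite /greedy_set -[take m (order (s b))](take_takel _ (leqnSn m)) takeE'.
  by rewrite take_takel.
case: b_disp; rewrite -bE.
have m_gt0 : (0 < m)%N.
  rewrite lt0n; apply: contra b_first => /eqP m0; rewrite /greedy_first.
  by have := bE; rewrite m0; case: (order (s b)) m_lt' => //= j o _ ->.
case: i_listed => [i_disp|]; last first.
  move/greedy_first_index; rewrite -/n => n0.
  by move: mn; rewrite n0 ltnS leqNgt m_gt0.
have [P_size P_value] := indispensable_prefix i_disp.
rewrite -/n in P_size P_value.
have PP : prefix g m \subset prefix (s i) n by rewrite PE prefix_subset.
apply: (proj2 (indispensable_nth _ _ _)) => //; rewrite bE PE'.
  apply/andP; split.
    exact: le_trans (set_size_le s_gt0 PP) (ltW (lt_trans P_size b_gt)).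
  rewrite ltrDr; have m1_lt : (m.-1 < size (order g))%N.
    by apply: leq_ltn_trans m_lt; apply: leq_pred.
  rewrite -(prednK m_gt0) (prefixS i) // set_sizeU1 ?nth_order_notin //.
  by apply: ltr_wpDr => //; apply: sumr_ge0 => j _; apply/ltW.
(* The value of the [m] items is below the marginal of [i] over them, and [b] is both denser and
   larger than [i]. *)
apply: (le_lt_trans (f_monotone PP)); apply: (lt_le_trans P_value).
apply: (le_trans (marginal_le f_monotone f_submodular _ PP)).
have mE j : marginal f (prefix g m) j = density s f (prefix g m) j * s j.
  by rewrite divfK ?gt_eqF.
have d_le := nth_order_max i m_lt i_fits i_notin; rewrite -/b in d_le.
rewrite !mE; apply: (le_trans (ler_wpM2r (ltW (s_gt0 i)) d_le)).
apply: ler_wpM2l (ltW b_gt); apply: divr_ge0; last exact: ltW.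
exact: marginal_ge0.
Qed.

(** The last property rests on processing by increasing size: when [j] is reached, the smaller [i]
    already makes the list nonempty. *)
Lemma priority_listP :
  [/\ pairwise (fun i j => s j <= s i) (priority_list s f),
      forall i, i \in priority_list s f ->
        indispensable s f i \/ greedy_first s f i,
      forall i, indispensable s f i -> i \in priority_list s f &
      forall i j, i \in priority_list s f -> s i < s j ->
        greedy_first s f j -> j \in priority_list s f].
Proof.
rewrite /priority_list; set step := (X in foldl X).
set l := sort _ _.
have l_mem i : i \in l by rewrite mem_sort mem_enum.
have : pairwise (fun i j => s i <= s j) l.
  rewrite -sorted_pairwise; last by move=> j i k; apply: le_trans.
  by apply: sort_sorted => i j; apply: le_total.
suff spec : pairwise (fun i j => s i <= s j) l ->
  [/\ {subset foldl step [::] l <= l},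
    pairwise (fun i j => s j <= s i) (foldl step [::] l),
    forall i, i \in foldl step [::] l ->
        indispensable s f i \/ greedy_first s f i,
    forall i, i \in l -> indispensable s f i -> i \in foldl step [::] l &
    forall i j, j \in l -> i \in foldl step [::] l -> s i < s j ->
        greedy_first s f j -> j \in foldl step [::] l].
  by case/spec=> _ F1 F2 F3 F4; split=> // [i|i j]; [apply: F3|apply: F4].
elim/last_ind: l {l_mem} => [|l i IH]; first by split.
rewrite pairwise_rcons foldl_rcons => /andP[/allP l_le /IH[]].
set F := foldl step [::] l => Fl F1 F2 F3 F4; rewrite [step F i]/step.
case: ifP => [listed|/negbT]; last first.
  rewrite negb_or => /andP[/asboolPn i_disp i_first]; split=> //.
  - by move=> j /Fl jl; rewrite mem_rcons inE jl orbT.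
  - by move=> j; rewrite mem_rcons inE => /predU1P[->//|]; apply: F3.
  - move=> j k; rewrite mem_rcons inE => /predU1P[->|kl]; last exact: F4 kl.
    move=> jF _ k_first; move: i_first; rewrite k_first /=.
    by case: (F) jF.
split.
- move=> j; rewrite mem_rcons !inE => /predU1P[->|/Fl ->].
    by rewrite eqxx.
  by rewrite orbT.
- by rewrite /= F1 andbT; apply/allP => j /Fl; apply: l_le.
- move=> j; rewrite inE => /predU1P[->|]; last exact: F2.
  by case/orP: listed => [/asboolP|/andP[]]; [left|right].
- move=> j; rewrite mem_rcons !inE => /predU1P[->|]; first by rewrite eqxx.
  by move=> jl /(F3 _ jl) ->; rewrite orbT.
- move=> j k; rewrite mem_rcons !inE => /predU1P[->|kl]; first by rewrite eqxx.
  case/predU1P=> [->|jF] jk k_first; last by rewrite (F4 j) ?orbT.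
  by have := l_le _ kl; rewrite /= leNgt jk.
Qed.

(** * Execution of the three steps *)

Lemma pack_subset g A (p : policy N) : A \subset pack s g A p.
Proof.
elim: p A => [|C i p IHp q IHq] A //=; case: ifP => _; last exact: IHq.
exact: subset_trans (subsetUr _ _) (IHp _).
Qed.

(** The candidates always include every unpacked item of size at most [g]. An attempted item larger
    than [g] discards none of these; any other is the next greedy item, which fits while [m] is
    below the greedy index. *)
Lemma pack_step3 g m n A M : (m <= greedy_index s f g)%N -> 0 < g ->
  A = prefix g m -> fitting s g :\: A \subset M -> [disjoint A & M] ->
  (#|M| <= n)%N ->
  prefix g (greedy_index s f g) \subset pack s g A (step3 s f n A M).
Proof.
move=> mk g_gt0; elim: n m A M mk => [|n IH] m A M mk AE FM AM Mn.
  move: Mn FM; rewrite leqn0 cards_eq0 => /eqP->.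
  rewrite subset0 setD_eq0; apply: subset_trans.
  by apply/subsetP => i /prefix_fits; rewrite inE.
have [mE|m_neq] := eqVneq m (greedy_index s f g).
  by rewrite -mE -AE; apply: pack_subset.
have m_lt_k : (m < greedy_index s f g)%N by rewrite ltn_neqAle m_neq.
have m_lt : (m < size (order g))%N.
  exact: leq_trans m_lt_k (greedy_index_size s f g).
case oE : (order g) (m_lt) => [//|i0 o] _; set b := nth i0 (order g) m.
have b_fits : s b <= g by rewrite -(mem_order s f) mem_nth.
have b_notin := nth_order_notin i0 m_lt; rewrite -/b -AE in b_notin.
have bM : b \in M by apply: (subsetP FM); rewrite !inE b_notin b_fits.
have [i bestE] := best_exists s f A bM; rewrite /= bestE /=.
have [iM i_max] := bestP bestE.
have iA : i \notin A.
  by apply/negP => iA; have := disjointFr AM iA; rewrite iM.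
have [i_fits|i_big] := leP (s i) g; last first.
  rewrite ifN; last first.
    rewrite /fits -ltNge; apply: ltr_wpDl => //.
    by apply: sumr_ge0 => j _; apply/ltW.
  apply: (IH m) => //.
  - apply/subsetP => j jF; rewrite inE (subsetP FM) //=.
    by apply: le_lt_trans i_big; move: jF; rewrite !inE => /andP[].
  - apply: disjointWr AM; apply/subsetP => j; by rewrite inE => /andP[].
  rewrite -ltnS; apply: leq_trans Mn; apply: proper_card; apply/properP; split.
    by apply/subsetP => j; rewrite inE => /andP[].
  by exists i => //; rewrite inE ltxx andbF.
have iE : b = i.
  apply: order_next => //; rewrite -AE // => j j_fits jA.
  by apply: i_max; apply: (subsetP FM); rewrite !inE jA j_fits.
have AS : i |: A = prefix g m.+1 by rewrite (prefixS i0) // -/b iE AE.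
rewrite ifT; last first.
  rewrite /fits addrC -set_sizeU1 // AS.
  apply: le_trans (greedy_index_fits s f g_gt0).
  by apply: set_size_le => //; apply: prefix_subset.
apply: (IH m.+1) => //.
- apply/subsetP => j; rewrite !inE negb_or => /andP[/andP[ji jA] j_fits].
  by rewrite ji (subsetP FM) // !inE jA.
- rewrite disjoint_subset; apply/subsetP => j; rewrite !inE.
  by case/predU1P => [->|jA]; rewrite ?eqxx // (disjointFr AM jA) andbF.
- by rewrite -ltnS; apply: leq_trans Mn; rewrite (cardsD1 i M) iM.
Qed.

Lemma pack_step2 g l A M : uniq l -> [disjoint A & [set i in l]] ->
  size_of (A :|: [set i in l]) <= g ->
  let A' := A :|: [set i in l] in let M' := M :\: [set i in l] in
  pack s g A (step2 s f l A M) = pack s g A' (step3 s f #|M'| A' M').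
Proof.
elim: l A M => [|i l IH] A M /=.
  by rewrite set_nil setU0 setD0.
case/andP=> il l_uniq; rewrite set_cons => Al A_fits.
have iA : i \notin A.
  by apply/negP => iA; have := disjointFr Al iA; rewrite setU11.
rewrite ifT; last first.
  rewrite /fits addrC -set_sizeU1 //; apply: le_trans A_fits.
  by apply: set_size_le => //; rewrite setUA [A :|: _]setUC subsetUl.
rewrite IH // ?setDDl -?setUA ?(setUCA [set i]) //.
rewrite disjoint_subset; apply/subsetP => j; rewrite !inE.
case/predU1P => [->//|jA]; have := disjointFr Al jA.
by rewrite !inE => /negbT; rewrite negb_or => /andP[].
Qed.

(** A rejected item is larger than [g], so the reduced candidate set keeps [fitting s g]; as [F] is
    sorted, its first fitting item is a largest one. *)
Lemma pack_step1 g (F : seq N) M : pairwise (fun i j => s j <= s i) F ->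
  fitting s g \subset M ->
  (exists M', [/\ fitting s g \subset M', forall i, i \in F -> g < s i &
     pack s g set0 (step1 s f F M) = pack s g set0 (step2 s f [::] set0 M')]) \/
  (exists i M', [/\ i \in F, s i <= g, fitting s g \subset M',
     forall j, j \in F -> s j <= g -> s j <= s i &
     pack s g set0 (step1 s f F M) = pack s g [set i]
       (step2 s f
          (if `[< indispensable s f i >] then predecessors s f i else [::])
          [set i] (M' :\ i))]).
Proof.
elim: F M => [|i F IH] M /=; first by left; exists M.
case/andP=> /allP F_le F_pair FM; rewrite /fits set_size0 add0r setU0.
case: leP => [i_fits|i_big].
  right; exists i, M; split=> //; first exact: mem_head.
  by move=> j; rewrite inE => /predU1P[->//|/F_le].
have [||[M' [FM' F_big ->]]|[j [M' [jF j_fits FM' j_max ->]]]] :=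
  IH [set j in M | s j < s i].
- by [].
- apply/subsetP => j jF; rewrite inE (subsetP FM) //=.
  by apply: le_lt_trans i_big; rewrite inE in jF.
- left; exists M'; split=> // j; rewrite inE => /predU1P[->//|]; exact: F_big.
- right; exists j, M'; split=> //; first by rewrite inE jF orbT.
  move=> k; rewrite inE => /predU1P[->|]; last exact: j_max.
  by rewrite leNgt i_big.
Qed.

Lemma agreedy_branch g i : next_item s f g = Some i ->
  agreedy s f g = prefix g (greedy_index s f g) \/ agreedy s f g = [set i].
Proof. by move=> nextE; rewrite /agreedy nextE; case: ifP; [left|right]. Qed.

(** * Comparison of the policy with AGreedy *)

Lemma agreedy_le_outcome g : 0 < g ->
  f (agreedy s f g) <= f (outcome s (robust_policy s f) g).
Proof.
move=> g_gt0; rewrite /outcome /robust_policy.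
set k := greedy_index s f g.
have [F_sorted F_listed F_disp F_first] := priority_listP.
set F := priority_list s f in F_sorted F_listed F_disp F_first *.
have singleton i : next_item s f g = Some i -> agreedy s f g = [set i] ->
    [/\ i \in F, s i <= g & size_of (prefix g k) < s i].
  move=> nextE agreedyE; split; last exact: next_item_size agreedyE.
    by apply: F_disp; exists g.
  have [k_lt iE] := next_item_nth i nextE.
  by rewrite -(mem_order s f) -iE mem_nth.
have outcome_prefix A : prefix g k \subset A ->
    (forall i, next_item s f g = Some i -> agreedy s f g <> [set i]) ->
    f (agreedy s f g) <= f A.
  move=> PA no_singleton; apply: f_monotone.
  case nextE: (next_item s f g) => [i|]; last by rewrite /agreedy nextE.
  by have [->|/no_singleton[]] := agreedy_branch nextE.
have [[M [FM F_big ->]]|[i [M [iF i_fits FM i_max ->]]]] :=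
  pack_step1 F_sorted (subsetT (fitting s g)).
- apply: outcome_prefix.
    apply: (pack_step3 (m := 0)) => //.
    + by rewrite prefix0.
    + by rewrite setD0.
    + by rewrite disjoints_subset sub0set.
  move=> i nextE agreedyE; have [iF i_fits _] := singleton i nextE agreedyE.
  by have := F_big i iF; rewrite ltNge i_fits.
set n := index i (order (s i)).
have [n_lt takeE] : (n < size (order g))%N /\
    take n.+1 (order g) = take n.+1 (order (s i)).
  apply: take_order_ge => //.
    exact: F_listed.
  move=> b /andP[b_gt b_fits].
  have bF : b \notin F.
    by apply/negP => /i_max /(_ b_fits); rewrite leNgt b_gt.
  split; first by move=> /F_disp; apply/negP.
  by apply: contra bF; apply: F_first iF b_gt.
have n_lt_i : (n < size (order (s i)))%N by rewrite index_mem mem_order.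
have iE : nth i (order g) n = i.
  by rewrite -(nth_take i (ltnSn n)) takeE nth_take // nth_index // mem_order.
have takeE' : take n (order g) = take n (order (s i)).
  by rewrite -[LHS](take_takel _ (leqnSn n)) takeE take_takel.
have PE : prefix g n = prefix (s i) n by rewrite /greedy_set takeE'.
have PS : prefix g n.+1 = i |: prefix g n by rewrite (prefixS i) // iE.
have i_notin : i \notin prefix g n by rewrite -{1}iE nth_order_notin.
set l := if _ then _ else _.
(* If [i] is not indispensable, it is first in its greedy order, so [n = 0] and both lists are
   empty. *)
have lE : l = take n (order g).
  rewrite /l takeE'; case: asboolP => // i_disp.
  case: (F_listed i iF) => // /greedy_first_index i_first.
  by rewrite /n i_first take0.
have [P_fits|P_over] := leP (size_of (prefix g n.+1)) g.
- have nk : (n.+1 <= k)%N by apply: greedy_index_max.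
  apply: outcome_prefix; last first.
    (* A returned singleton [j] would have size at most [s i], hence at most that of [prefix g k],
       which is smaller than [j]. *)
    move=> j nextE agreedyE; have [jF j_fits] := singleton j nextE agreedyE.
    apply/negP; rewrite -leNgt; apply: le_trans (i_max _ jF j_fits) _.
    apply: (@le_trans _ _ (size_of (prefix g n.+1))).
      rewrite PS set_sizeU1 // lerDl; apply: sumr_ge0 => ? _; exact/ltW.
    by apply: set_size_le => //; apply: prefix_subset.
  have lPE : [set j in l] = prefix g n by rewrite lE.
  rewrite pack_step2 // ?lPE -?PS //.
  + apply: (pack_step3 (m := n.+1)) => //.
      apply/subsetP => j; rewrite PS !inE negb_or => /andP[/andP[ji jP] j_fits].
      by rewrite jP ji (subsetP FM) // inE.
    rewrite PS disjoint_subset; apply/subsetP => j; rewrite !inE.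
    by case/orP => ->; rewrite ?andbF.
  + by rewrite lE take_uniq // uniq_order.
  + by rewrite disjoints_subset sub1set inE.
(* A greedy-first [i] would be the whole of [prefix g n.+1], and [i] fits. *)
have i_disp : indispensable s f i.
  case: (F_listed i iF) => // i_first; move: P_over.
  have n0 : n = 0%N by exact: greedy_first_index.
  rewrite PS n0 prefix0 set_sizeU1 ?inE // set_size0 addr0.
  by rewrite ltNge i_fits.
have [P_size P_value] := indispensable_prefix i_disp.
rewrite -/n -PE in P_size P_value.
have [kE _] : k = n /\ indispensable s f (nth i (order g) n).
  apply: indispensable_nth => //;
    rewrite iE // [_ + s i]addrC -set_sizeU1 // -PS.
  by rewrite P_over andbT; apply: le_trans i_fits; apply: ltW.
have nextE : next_item s f g = Some i.
  by rewrite /next_item -/k kE onthE (nth_map i) // iE.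
rewrite /agreedy nextE -/k kE /= [_ <= f (prefix g n)]leNgt P_value /=.
by apply: f_monotone; apply: pack_subset.
Qed.

End RobustPolicy.

Theorem theorem9 (R : realType) (N : finType) (s : N -> R) (f : {set N} -> R)
    (c : R) (s_gt0 : forall i : N, 0 < s i)
    (f_ge0 : forall A : {set N}, 0 <= f A)
    (f_normalized : normalized f) (f_monotone : monotone f)
    (f_submodular : submodular f)
    (f_gt0 : forall j : N, 0 < f [set j])
    (c_curvature : curvature f = c) (c_range : 0 < c <= 1)
    (f_no_ties : no_ties s f) :
  (exists! x : R, critical_point c x) /\
  forall x : R, critical_point c x ->
    robustness_at_least s f ((1 - x) / (2 - (2 - c) * x)) (robust_policy s f).
Proof.
have [c_gt0 c_le1] := andP c_range; split.
  have [x x_crit] := critical_point_exists c_gt0 c_le1.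
  by exists x; split=> // y; apply: critical_point_unique.
move=> x x_crit g A g_gt0 [A_fits _].
have densities_distinct (h : R) (j : nat) : 0 < h ->
    {in fitting s h :\: greedy_set s f h j &,
      injective (density s f (greedy_set s f h j))}.
  by move=> /f_no_ties[].
apply: le_trans (agreedy_le_outcome s_gt0 f_normalized f_monotone f_submodular
  densities_distinct g_gt0).
(* [i0] is the default entry for [nth]; without items only [A = set0] occurs. *)
have [i0 _|N0] := pickP N; last first.
  have -> : A = set0 by apply/setP => i; have := N0 i.
  by rewrite f_normalized mulr0.
exact: (agreedy_value s_gt0 f_normalized f_monotone f_submodular f_gt0
  c_curvature c_gt0 c_le1 i0 g_gt0 x_crit A_fits).
Qed.
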